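(* Let $d\ge2$ and let $q^{\mathrm{pu}}$ be the $\varepsilon$-LDP $\texttt{PrivUnit}_2$ mechanism on $\mathbb{S}^{d-1}$ with parameters $p_0$ and $\gamma$ and estimator $\hat{\mathbf{x}}^{\mathrm{pu}}=\mathbf{z}/m_{\mathrm{pu}}$. Let $q^{\mathrm{mmrc}}$ denote the MMRC mechanism simulating $\texttt{PrivUnit}_2$ with $N$ candidates and estimator $\hat{\mathbf{x}}^{\mathrm{mmrc}}=\mathbf{z}_K/m_{\mathrm{mmrc}}$. Let $\lambda>0$. If \[ N\ge\frac{e^{2\varepsilon}}{2}\Big(\frac{2(1+\lambda)}{\lambda(p_0-1/2)}\Big)^2\ln\Big(\frac{4(1+\lambda)}{\lambda(p_0-1/2)}\Big), \] then for every $\mathbf{x}\in\mathbb{S}^{d-1}$, \[ \mathbb{E}_{q^{\mathrm{mmrc}}}\big[\|\hat{\mathbf{x}}^{\mathrm{mmrc}}-\mathbf{x}\|_2^2\big]\le(1+\lambda)^2E+2(1+\lambda)(2+\lambda)\sqrt{E}+(2+\lambda)^2,\qquad E=\mathbb{E}_{q^{\mathrm{pu}}}\big[\|\hat{\mathbf{x}}^{\mathrm{pu}}-\mathbf{x}\|_2^2\big]. \]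
   Context: $\texttt{PrivUnit}_2$ with parameters $\gamma\in[0,1]$, $p_0\ge1/2$ (chosen so the mechanism is $\varepsilon$-LDP, i.e. its output density ratio between any two inputs is at most $e^\varepsilon$): on input $\mathbf{x}\in\mathbb{S}^{d-1}$, output $\mathbf{z}$ uniform on $\mathsf{Cap}_{\mathbf{x}}=\{\mathbf{z}\in\mathbb{S}^{d-1}:\langle\mathbf{z},\mathbf{x}\rangle\ge\gamma\}$ with probability $p_0$ and uniform on its complement otherwise. Its density w.r.t. the uniform probability on the sphere is $c_1=p_0/\bar\theta$ on the cap and $c_2=(1-p_0)/(1-\bar\theta)$ off it, where $\bar\theta=\mathbb{P}_{\mathbf{z}\sim\mathrm{Unif}(\mathbb{S}^{d-1})}(\mathbf{z}\in\mathsf{Cap}_{\mathbf{x}})$. For $p\in[0,1]$ let $m(p)=\frac{(1-\gamma^2)^{\alpha}}{2^{d-2}(d-1)}\big[\frac{p}{B(\alpha,\alpha)-B(\tau;\alpha,\alpha)}-\frac{1-p}{B(\tau;\alpha,\alpha)}\big]$, $\alpha=\frac{d-1}2$, $\tau=\frac{1+\gamma}2$, $B(x;a,b)=\int_0^xt^{a-1}(1-t)^{b-1}dt$, $B(a,b)=B(1;a,b)$; $m_{\mathrm{pu}}=m(p_0)$. MMRC simulating $\texttt{PrivUnit}_2$: draw $\mathbf{z}_1,\dots,\mathbf{z}_N$ i.i.d. uniform on $\mathbb{S}^{d-1}$; $\theta=\frac1N\#\{k:\mathbf{z}_k\in\mathsf{Cap}_{\mathbf{x}}\}$; $\pi^{\mathrm{mrc}}(k)=\frac1N\frac{c_i}{\theta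 c_1+(1-\theta)c_2}$ ($i=1$ for cap candidates, $i=2$ otherwise); $t_u=\frac1N\frac{c_1}{\bar\theta c_1+(1-\bar\theta)c_2}$, $t_l=\frac1N\frac{c_2}{\bar\theta c_1+(1-\bar\theta)c_2}$; $\pi^{\mathrm{mmrc}}=\pi^{\mathrm{mrc}}$ if $\theta=\bar\theta$; if $\theta<\bar\theta$, $\pi^{\mathrm{mmrc}}(k)=t_u$ on cap candidates and $\frac{1-N\theta t_u}{N(1-\theta)}$ otherwise; if $\theta>\bar\theta$, $\pi^{\mathrm{mmrc}}(k)=t_l$ on non-cap candidates and $\frac{1-N(1-\theta)t_l}{N\theta}$ otherwise. $K\sim\pi^{\mathrm{mmrc}}$, $p_{\mathrm{mmrc}}=\mathbb{P}(\mathbf{z}_K\in\mathsf{Cap}_{\mathbf{x}})$ and $m_{\mathrm{mmrc}}=m(p_{\mathrm{mmrc}})$. $\mathbb{E}_{q^{\mathrm{mmrc}}}$ is over the candidates and $K$. *)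

(* Defs.v *)
From HB Require Import structures.
From mathcomp Require Import all_boot all_order all_algebra.
From mathcomp Require Import all_classical all_reals all_analysis.
Set Implicit Arguments. Unset Strict Implicit. Unset Printing Implicit Defensive.
Import Order.TTheory GRing.Theory Num.Theory.
Import numFieldNormedType.Exports.
Local Open Scope classical_set_scope.
Local Open Scope ring_scope.

Section Defs.
Context {R : realType}.

Definition dotv {d : nat} (u v : 'rV[R]_d) : R := \sum_(i < d) u 0 i * v 0 i.
Definition sqnorm {d : nat} (u : 'rV[R]_d) : R := dotv u u.
Definition Ssphere (d : nat) : set 'rV[R]_d := [set z | sqnorm z = 1].
Definition Cap {d : nat} (gamma : R) (x : 'rV[R]_d) : set 'rV[R]_d :=
  [set z | gamma <= dotv z x].

Definition borelRd (d : nat) : set (set 'rV[R]_d) := <<s open >>.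

Context {dO : measure_display} {Omega : measurableType dO}.

Definition Prob (P : probability Omega R) (A : set Omega) : R := fine (P A).

Definition rv_measurable {d : nat} (Z : Omega -> 'rV[R]_d) :=
  forall A, borelRd A -> measurable (Z @^-1` A).

(* Z is uniformly distributed on the sphere: its law is the (unique)
   rotation-invariant probability on R^d carried by the sphere. *)
Definition unif_sphere {d : nat} (P : probability Omega R) (Z : Omega -> 'rV[R]_d) :=
  [/\ rv_measurable Z,
      P (Z @^-1` @Ssphere d) = 1%E &
      forall Q : 'M[R]_d, Q *m Q^T = 1%:M ->
        forall A, borelRd A -> P (Z @^-1` A) = P ((fun w => Z w *m Q) @^-1` A)].

Definition mutually_indep {d N : nat} (P : probability Omega R)
  (Z : 'I_N -> Omega -> 'rV[R]_d) :=
  forall A : 'I_N -> set 'rV[R]_d, (forall k, borelRd (A k)) ->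
    Prob P [set w | forall k, A k (Z k w)] = \prod_(k < N) Prob P (Z k @^-1` A k).

Definition thetabar {d : nat} (P : probability Omega R) (U : Omega -> 'rV[R]_d)
  (gamma : R) (x : 'rV[R]_d) : R := Prob P (U @^-1` Cap gamma x).

End Defs.

Section Defs2.
Context {R : realType}.

Definition betainc (a b x : R) : R :=
  fine (\int[@lebesgue_measure R]_(t in [set t : R | 0 <= t <= x])
          ((t `^ (a - 1)) * ((1 - t) `^ (b - 1)))%:E).
Definition betaf (a b : R) : R := betainc a b 1.

Definition mPU (d : nat) (gamma p : R) : R :=
  let alpha := (d%:R - 1) / 2 in
  let tau := (1 + gamma) / 2 in
  (1 - gamma ^+ 2) `^ alpha / (2 ^+ (d - 2) * (d%:R - 1)) *
  (p / (betaf alpha alpha - betainc alpha alpha tau) - (1 - p) / betainc alpha alpha tau).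

(* PrivUnit2 constants and density w.r.t. the uniform probability *)
Definition c1 (p0 thb : R) : R := p0 / thb.
Definition c2 (p0 thb : R) : R := (1 - p0) / (1 - thb).
Definition pu_density {d : nat} (gamma p0 thb : R) (x z : 'rV[R]_d) : R :=
  if gamma <= dotv z x then c1 p0 thb else c2 p0 thb.

Definition pi_mmrc {d N : nat} (gamma p0 thb : R) (x : 'rV[R]_d)
  (zs : 'I_N -> 'rV[R]_d) (k : 'I_N) : R :=
  let inc := fun j => gamma <= dotv (zs j) x in
  let a := c1 p0 thb in
  let b := c2 p0 thb in
  let Nr : R := N%:R in
  let theta := (\sum_(j < N) (if inc j then 1 else 0 : R)) / Nr in
  let tu := (1 / Nr) * (a / (thb * a + (1 - thb) * b)) in
  let tl := (1 / Nr) * (b / (thb * a + (1 - thb) * b)) in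
  if theta == thb then
    (1 / Nr) * ((if inc k then a else b) / (theta * a + (1 - theta) * b))
  else if theta < thb then
    (if inc k then tu else (1 - Nr * theta * tu) / (Nr * (1 - theta)))
  else
    (if inc k then (1 - Nr * (1 - theta) * tl) / (Nr * theta) else tl).

End Defs2.

(* Main.v *)
(** All outputs lie on the unit sphere, so the MMRC risk is at most
    [(1/m_mmrc + 1)^2] while the PrivUnit2 risk [E] is at least [(1/m_pu - 1)^2];
    it therefore suffices that [m_pu <= (1 + lambda) m_mmrc]. Since [m] is affine
    and increasing, with its zero at most [1/2] by the symmetry of the beta
    integral, this follows once the cap probability [p_mmrc] falls short of [p0] by
    at most [lambda (p0 - 1/2) / (1 + lambda)].

    Given the candidates, MMRC draws the cap with a probability that depends only
    on the fraction [theta] of candidates in the cap and is at least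
    [p0 - c1 |theta - thb|]. As [theta] is an empirical frequency, its mean
    deviation from [thb] is at most [sqrt (thb (1 - thb) / N)], and local privacy
    gives [c1 <= e^eps]. This second-moment bound takes the place of a
    concentration inequality. *)

Require Import Defs.
From mathcomp Require Import all_boot all_order all_algebra finmap.
From mathcomp Require Import all_classical all_reals all_analysis.
From mathcomp Require Import measurable_realfun ring lra.
Set Implicit Arguments. Unset Strict Implicit. Unset Printing Implicit Defensive.
Import Order.TTheory GRing.Theory Num.Theory.
Import numFieldNormedType.Exports.
Local Open Scope classical_set_scope.
Local Open Scope ring_scope.

Section UnitIntervalIntegrals.
Context {R : realType}.
Local Notation mu := (@lebesgue_measure R).

Lemma measurable_onem :
  measurable_fun setT (fun t : measurableTypeR R => 1 - t : measurableTypeR R).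
Proof. exact: measurable_funB. Qed.

Lemma lebesgue_measure_onem (A : set R) : measurable A ->
  pushforward mu (fun t => 1 - t : measurableTypeR R) A = mu A.
Proof.
have monem := measurable_onem.
move=> mA; apply/esym/lebesgue_measure_unique => //= _ [[a b]] _ <-.
rewrite /pushforward/=.
have -> : (fun t : R => 1 - t) @^-1` `]a, b] = `[1 - b, 1 - a[%classic.
  by apply/seteqP; split=> t /=; rewrite !in_itv/= => /andP[? ?]; apply/andP; lra.
rewrite !lebesgue_measure_itv/= !lte_fin ltrD2l ltrN2.
by case: ifPn => // _; rewrite -!EFinD; congr _%:E; lra.
Qed.

Lemma ge0_integral_onem (D : set R) (f : R -> \bar R) :
  measurable D -> measurable_fun D f -> (forall t, 0 <= f t)%E ->
  (\int[mu]_(t in D) f t =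
   \int[mu]_(t in (fun t : R => (1 - t)%R) @^-1` D) f (1 - t)%R)%E.
Proof.
move=> mD mf f_ge0; have monem := measurable_onem.
rewrite -(@ge0_integral_pushforward _ _ _ _ _ _ monem _ D f)//.
by apply: eq_measure_integral => //= B mB _; exact/esym/lebesgue_measure_onem.
Qed.

Lemma integral_powR_itv (a e : R) : 0 < a -> 0 < e < 1 ->
  (\int[mu]_(t in `[e, 1%R]) (t `^ (a - 1))%:E = (a^-1 * (1 - e `^ a))%:E)%E.
Proof.
move=> a_gt0 /andP[e_gt0 e_lt1].
have primitive_derive (t : R) : 0 < t ->
    is_derive t 1 (fun t : R => a^-1 * t `^ a) (t `^ (a - 1)).
  move=> t_gt0; have dpow := is_derive1_powR a t_gt0.
  apply: is_derive_eq (is_deriveZ a^-1 dpow) _.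
  by rewrite scalerA mulVf ?scale1r// gt_eqF.
have primitive_cont (t : R) : 0 < t -> {for t, continuous (fun t : R => a^-1 * t `^ a)}.
  by move=> /primitive_derive[dt _]; apply/differentiable_continuous/derivable1_diffP.
rewrite (@continuous_FTC2 _ _ (fun t => a^-1 * t `^ a))//.
- by rewrite powR1 -EFinB mulrBr.
- apply: continuous_in_subspaceT => t; rewrite inE/= in_itv/= => /andP[e_le _].
  have [dpow _] := is_derive1_powR (a - 1) (lt_le_trans e_gt0 e_le).
  by apply/differentiable_continuous/derivable1_diffP.
- split.
  + move=> t; rewrite in_itv/= => /andP[e_lt _].
    by have [] := primitive_derive t (lt_trans e_gt0 e_lt).
  + by apply: cvg_at_right_filter; exact: primitive_cont.
  + by apply: cvg_at_left_filter; exact: primitive_cont.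
- move=> t; rewrite in_itv/= => /andP[e_lt _]; rewrite derive1E.
  by have [_ ->] := primitive_derive t (lt_trans e_gt0 e_lt).
Qed.

Lemma integral_powR (a : R) : 0 < a ->
  (\int[mu]_(t in `[0%R, 1%R]) (t `^ (a - 1))%:E = (a^-1)%:E)%E.
Proof.
move=> a_gt0; rewrite -integral_itv_obnd_cbnd; last first.
  by apply/measurable_EFinP; exact: measurable_funTS.
pose cut (n : nat) : set R := `[n.+2%:R^-1, 1]%classic.
have -> : `]0, 1]%classic = \bigcup_n cut n :> set R.
  apply/seteqP; split=> [t|t [n _]]; rewrite /cut/= !in_itv/=.
    move=> /andP[t_gt0 t_le1].
    have [k] := ltr_add_invr t_gt0; rewrite add0r => kt.
    exists k => //=; rewrite in_itv/= t_le1 andbT.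
    by rewrite (le_trans _ (ltW kt))// lef_pV2 ?posrE// ler_nat.
  by move=> /andP[nt ->]; rewrite andbT (lt_le_trans _ nt)// invr_gt0 ltr0n.
have cut_cvg : (\int[mu]_(t in cut n) (t `^ (a - 1))%:E)%E @[n --> \oo] -->
    (\int[mu]_(t in \bigcup_n cut n) (t `^ (a - 1))%:E)%E.
  apply: ge0_nondecreasing_set_cvg_integral => //.
  - move=> m n mn; apply/subsetPset => t; rewrite /cut/= !in_itv/= => /andP[mt ->].
    by rewrite andbT (le_trans _ mt)// lef_pV2 ?posrE// ler_nat !ltnS.
  - by move=> n; exact: measurable_itv.
  - by move=> n; apply/measurable_EFinP; exact: measurable_funTS.
  - by move=> n t _; rewrite lee_fin powR_ge0.
have integral_cut n : (\int[mu]_(t in cut n) (t `^ (a - 1))%:E =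
    (a^-1 * (1 - n.+2%:R^-1 `^ a))%:E)%E.
  by apply: integral_powR_itv => //; rewrite invr_gt0 ltr0n invf_lt1 ?ltr1n.
have powR_inv_cvg0 : n.+2%:R^-1 `^ a @[n --> \oo] --> (0 : R).
  have /cvg_at_rightP/(_ (fun n => n.+2%:R^-1)) := powR_cvg0 a_gt0; apply.
  split=> [n|]; first by rewrite invr_gt0 ltr0n.
  by have := @cvg_harmonic R; rewrite -cvg_shiftS.
move: cut_cvg; rewrite (funext integral_cut) => /cvg_unique; apply => //.
apply: cvg_EFin; first exact: nearW.
have : a^-1 * (1 - n.+2%:R^-1 `^ a) @[n --> \oo] --> a^-1 * (1 - 0).
  by apply: cvgM; [exact: cvg_cst | apply: cvgB => //; exact: cvg_cst].
by rewrite subr0 mulr1.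
Qed.

End UnitIntervalIntegrals.

Section SymmetricBeta.
Context {R : realType} (a : R).
Local Notation mu := (@lebesgue_measure R).

Definition beta_kernel (t : R) : R := t `^ (a - 1) * (1 - t) `^ (a - 1).

Local Notation I i := (\int[mu]_(t in [set` i]) (beta_kernel t)%:E)%E.

Lemma beta_kernel_ge0 t : (0 <= (beta_kernel t)%:E)%E.
Proof. by rewrite lee_fin mulr_ge0 ?powR_ge0. Qed.

Lemma beta_kernel_onem t : beta_kernel (1 - t) = beta_kernel t.
Proof. by rewrite /beta_kernel subKr mulrC. Qed.

Lemma measurable_beta_kernel (D : set R) :
  measurable_fun D (fun t => (beta_kernel t)%:E).
Proof.
apply/measurable_EFinP/measurable_funTS/measurable_funM => //.
by apply: (measurableT_comp (measurable_powR _)); exact: measurable_funB.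
Qed.

Lemma betaincE x : betainc a a x = fine (I `[0%R, x]).
Proof. by []. Qed.

Lemma integral_beta_kernel_split tau : 0 <= tau < 1 ->
  (I `[0%R, 1%R] = I `[0%R, tau] + I `]tau, 1%R])%E.
Proof.
move=> /andP[tau0 tau1]; rewrite -ge0_integral_setU//=.
- by congr (integral _ _ _); rewrite -itv_bndbnd_setU// bnd_simp ltW.
- exact: measurable_beta_kernel.
- by move=> t _; exact: beta_kernel_ge0.
- rewrite disj_set2E; apply/eqP; rewrite -subset0 => t []/=.
  by rewrite !in_itv/= => /andP[_ ?] /andP[]; rewrite ltNge => /negP.
Qed.

Lemma integral_beta_kernel_tail_le tau : 1 / 2 <= tau ->
  (I `]tau, 1%R] <= I `[0%R, tau])%E.
Proof.
move=> tau_ge; rewrite (ge0_integral_onem _ _ beta_kernel_ge0)//; last first.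
  exact: measurable_beta_kernel.
under eq_integral do rewrite beta_kernel_onem.
apply: ge0_subset_integral => //=.
- by rewrite -[X in measurable X]setTI; exact: measurable_funB.
- exact: measurable_beta_kernel.
- by move=> t _; exact: beta_kernel_ge0.
- by move=> t /=; rewrite !in_itv/= => /andP[? ?]; apply/andP; lra.
Qed.

Lemma integral_beta_kernel_tail_gt0 tau : 0 <= tau < 1 ->
  (0 < I `]tau, 1%R])%E.
Proof.
move=> /andP[tau_ge0 tau_lt1]; rewrite lt_neqAle integral_ge0 ?andbT; last first.
  by move=> t _; exact: beta_kernel_ge0.
apply/negP => /eqP/esym tail_eq0; have [M [mM M_null subM]] :
    ae_eq mu `]tau, 1%R]%classic (fun t => (beta_kernel t)%:E) (cst 0%E).
  apply/ae_eq_integral_abs => //; first exact: measurable_beta_kernel.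
  rewrite -[RHS]tail_eq0; apply: eq_integral => t _.
  by rewrite gee0_abs ?beta_kernel_ge0.
have : (mu (`]tau, 1%R[%classic : set R) <= mu M)%E.
  apply: le_measure; rewrite ?inE// => t /=; rewrite in_itv/= => /andP[? ?].
  apply: subM => /=; apply/not_implyP; split.
    by rewrite in_itv/=; apply/andP; lra.
  by move=> -[] /eqP; apply/negP; rewrite gt_eqF// mulr_gt0 ?powR_gt0//; lra.
by rewrite M_null lebesgue_measure_itv/= lte_fin tau_lt1 lee_fin; lra.
Qed.

Lemma beta_kernel_le t : 0 < a -> 0 <= t <= 1 / 2 ->
  beta_kernel t <= 2 * t `^ (a - 1).
Proof.
move=> a_gt0 /andP[t_ge0 t_le]; rewrite [leRHS]mulrC ler_wpM2l ?powR_ge0//.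
have t1_gt0 : 0 < 1 - t by lra.
rewrite -(ler_pM2l t1_gt0) mulr_powRB1 ?(ltW t1_gt0)//.
apply: (@le_trans _ _ (1 `^ a)); last by rewrite powR1; lra.
by rewrite ge0_ler_powR ?nnegrE; lra.
Qed.

Lemma integral_beta_kernel_lty : 0 < a -> (I `[0%R, 1%R] < +oo)%E.
Proof.
move=> a_gt0; pose majorant (t : R) := (2%:E * (t `^ (a - 1))%:E)%E.
have majorant_ge0 t : (0 <= majorant t)%E by rewrite mule_ge0// lee_fin powR_ge0.
have measurable_majorant (D : set R) : measurable_fun D majorant.
  by apply: emeasurable_funM => //; apply/measurable_EFinP/measurable_funTS.
have head_lty : (I `[0%R, (1 / 2)%R] < +oo)%E.
  have : (\int[mu]_(t in `[0%R, 1%R]) majorant t < +oo)%E.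
    rewrite ge0_integralZl//; first by rewrite integral_powR// -EFinM ltry.
      by apply/measurable_EFinP; exact: measurable_funTS.
    by move=> t _; rewrite lee_fin powR_ge0.
  apply: le_lt_trans.
  apply: (@le_trans _ _ (\int[mu]_(t in `[0%R, (1 / 2)%R]) majorant t)%E).
    apply: ge0_le_integral => //.
    - by move=> t _; exact: beta_kernel_ge0.
    - exact: measurable_beta_kernel.
    - exact: measurable_majorant.
    - move=> t; rewrite /= in_itv/= /majorant -EFinM lee_fin.
      exact: beta_kernel_le.
  apply: ge0_subset_integral => //; first exact: measurable_majorant.
  by move=> t /=; rewrite !in_itv/= => /andP[? ?]; apply/andP; lra.
rewrite (@integral_beta_kernel_split (1 / 2)); last by apply/andP; lra.
by rewrite lte_add_pinfty// (le_lt_trans _ head_lty)// integral_beta_kernel_tail_le.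
Qed.

Lemma betainc_tail_bounds tau : 0 < a -> 1 / 2 <= tau < 1 ->
  0 < betaf a a - betainc a a tau <= betainc a a tau.
Proof.
move=> a_gt0 /andP[tau_ge tau_lt].
have tau01 : 0 <= tau < 1 by apply/andP; lra.
have := integral_beta_kernel_lty a_gt0.
rewrite /betaf !betaincE (integral_beta_kernel_split tau01) => I_lty.
have I_ge0 i : (0 <= I i)%E.
  by apply: integral_ge0 => t _; exact: beta_kernel_ge0.
have tail_fin : I `]tau, 1%R] \is a fin_num.
  by rewrite ge0_fin_numE// (le_lt_trans _ I_lty)// leeDr.
have head_fin : I `[0%R, tau] \is a fin_num.
  by rewrite ge0_fin_numE// (le_lt_trans _ I_lty)// leeDl.
rewrite fineD// addrAC subrr add0r fine_le ?integral_beta_kernel_tail_le//.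
by rewrite fine_gt0// integral_beta_kernel_tail_gt0// -ge0_fin_numE.
Qed.

End SymmetricBeta.

Lemma mPU_affine (R : realType) (d : nat) (gamma : R) :
  (2 <= d)%N -> 0 <= gamma < 1 ->
  exists slope zero : R, [/\ 0 < slope, zero <= 1 / 2 &
    forall p, mPU d gamma p = slope * (p - zero)].
Proof.
move=> d_ge2 /andP[g_ge0 g_lt1]; rewrite /mPU /=.
have d2 : 2 <= d%:R :> R by rewrite ler_nat.
set a := (d%:R - 1) / 2; set scale := _ `^ a / _.
have scale_gt0 : 0 < scale.
  apply: divr_gt0; first by rewrite powR_gt0// subr_gt0 exprn_ilt1.
  by apply: mulr_gt0; [exact: exprn_gt0 | lra].
have a_gt0 : 0 < a by rewrite /a; lra.
have tau_bounds : 1 / 2 <= (1 + gamma) / 2 < 1 by apply/andP; lra.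
have /andP[] := betainc_tail_bounds a_gt0 tau_bounds.
set head := betainc _ _ _; set tail := _ - head => tail_gt0 tail_le.
have head_gt0 : 0 < head by exact: lt_le_trans tail_le.
have sum_gt0 : 0 < tail + head by exact: addr_gt0.
exists (scale * (tail^-1 + head^-1)), (tail / (tail + head)); split.
- by rewrite mulr_gt0// addr_gt0// invr_gt0.
- by rewrite ler_pdivrMr//; lra.
- by move=> p; field; rewrite !gt_eqF.
Qed.

(* The drop in cap probability that costs at most a factor [1 + lambda] in the
   scale [mPU]. *)
Definition cap_loss_budget {R : realType} (p0 lambda : R) : R :=
  lambda * (p0 - 1 / 2) / (1 + lambda).

Lemma mPU_inv_le (R : realType) (d : nat) (gamma p0 p lambda : R) :
  (2 <= d)%N -> 0 <= gamma < 1 -> 1 / 2 < p0 -> 0 < lambda ->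
  p0 - cap_loss_budget p0 lambda <= p ->
  0 <= (mPU d gamma p)^-1 <= (1 + lambda) * (mPU d gamma p0)^-1.
Proof.
move=> d_ge2 g01 p0_gt lambda_gt0 p_ge.
have [slope [zero [slope_gt0 zero_le mPU_eq]]] := mPU_affine d_ge2 g01.
have l1_gt0 : 0 < 1 + lambda by lra.
have zero_gap : (p0 - zero) / (1 + lambda) <= p - zero.
  apply: le_trans (lerB p_ge (lexx zero)).
  rewrite -subr_ge0 (_ : _ - _ = lambda * (1 / 2 - zero) / (1 + lambda)).
    by rewrite divr_ge0 ?mulr_ge0//; lra.
  by rewrite /cap_loss_budget; field; rewrite gt_eqF.
have m0_gt0 : 0 < mPU d gamma p0 / (1 + lambda).
  by rewrite divr_gt0// mPU_eq mulr_gt0//; lra.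
have m_ge : mPU d gamma p0 / (1 + lambda) <= mPU d gamma p.
  by rewrite !mPU_eq -mulrA ler_pM2l.
have m_gt0 := lt_le_trans m0_gt0 m_ge.
by rewrite invr_ge0 ltW//= -invf_div lef_pV2 ?posrE.
Qed.

Section EuclideanGeometry.
Context {R : realType} {d : nat}.
Implicit Types u v x y z : 'rV[R]_d.

Lemma dotvE u v : dotv u v = (u *m v^T) 0 0.
Proof. by rewrite mxE; apply: eq_bigr => i _; rewrite mxE. Qed.

Lemma mulmx_tr_dotv u v : u *m v^T = (dotv u v)%:M.
Proof. by rewrite dotvE -mx11_scalar. Qed.

Lemma dotvC u v : dotv u v = dotv v u.
Proof. by apply: eq_bigr => i _; rewrite mulrC. Qed.

Lemma dotv_mulmx u v (Q : 'M[R]_d) : dotv (u *m Q) v = dotv u (v *m Q^T).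
Proof. by rewrite !dotvE trmx_mul trmxK mulmxA. Qed.

Lemma dotvNr u v : dotv u (- v) = - dotv u v.
Proof. by rewrite -sumrN; apply: eq_bigr => i _; rewrite mxE mulrN. Qed.

Lemma dotvBr u v x : dotv u (v - x) = dotv u v - dotv u x.
Proof. by rewrite -sumrB; apply: eq_bigr => i _; rewrite !mxE mulrBr. Qed.

Lemma sqnormN u : sqnorm (- u) = sqnorm u.
Proof. by apply: eq_bigr => i _; rewrite !mxE mulrNN. Qed.

Lemma sqnorm_ge0 u : 0 <= sqnorm u.
Proof. by apply: sumr_ge0 => i _; rewrite -expr2 sqr_ge0. Qed.

Lemma sqnormZB (k : R) u v :
  sqnorm (k *: u - v) = k ^+ 2 * sqnorm u - 2 * k * dotv u v + sqnorm v.
Proof.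
rewrite /sqnorm /dotv !mulr_sumr -sumrB -big_split/=.
by apply: eq_bigr => i _; rewrite !mxE; ring.
Qed.

Lemma sqnormB u v : sqnorm (u - v) = sqnorm u - 2 * dotv u v + sqnorm v.
Proof. by rewrite -[u in LHS]scale1r sqnormZB; ring. Qed.

Lemma coord_sqr_le_sqnorm u i : u 0 i ^+ 2 <= sqnorm u.
Proof.
rewrite /sqnorm /dotv (bigD1 i)//= -expr2 lerDl.
by apply: sumr_ge0 => j _; rewrite -expr2 sqr_ge0.
Qed.

Lemma sqnorm_eq0 u : (sqnorm u == 0) = (u == 0).
Proof.
apply/eqP/eqP => [u0|->]; last by apply: big1 => i _; rewrite mxE mul0r.
apply/rowP => i; rewrite mxE; apply/eqP.
by rewrite -sqrf_eq0 eq_le sqr_ge0 -u0 coord_sqr_le_sqnorm.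
Qed.

Lemma normr_dotv_le1 u v : sqnorm u = 1 -> sqnorm v = 1 -> `|dotv u v| <= 1.
Proof.
move=> u1 v1; rewrite ler_norml.
have := sqnorm_ge0 (u - v); have := sqnorm_ge0 (u - (- v)).
by rewrite !sqnormB dotvNr sqnormN u1 v1 => ? ?; apply/andP; split; lra.
Qed.

Lemma sqnormZB_bounds (k : R) u v : sqnorm u = 1 -> sqnorm v = 1 ->
  (`|k| - 1) ^+ 2 <= sqnorm (k *: u - v) <= (`|k| + 1) ^+ 2.
Proof.
move=> u1 v1; rewrite sqnormZB u1 v1.
have : `|k * dotv u v| <= `|k|.
  by rewrite normrM ler_piMr// normr_dotv_le1.
rewrite ler_norml => /andP[lo hi].
have kk : k ^+ 2 = `|k| ^+ 2 by rewrite real_normK ?num_real.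
by apply/andP; split; lra.
Qed.

(* The witness is the reflection in the hyperplane orthogonal to [x - y]. *)
Lemma orthogonal_transitive x y : sqnorm x = sqnorm y ->
  exists2 Q : 'M[R]_d, Q *m Q^T = 1%:M & x *m Q = y.
Proof.
move=> xy; have [->|x_neq_y] := eqVneq x y.
  by exists 1%:M; rewrite ?trmx1 mulmx1.
pose v := x - y; pose s := sqnorm v.
have s_neq0 : s != 0 by rewrite /s sqnorm_eq0 subr_eq0.
have dotv_xv : dotv x v = s / 2.
  by rewrite /s /v sqnormB dotvBr -xy -/(sqnorm x); field.
pose reflection := 1%:M - (2 / s) *: (v^T *m v).
have reflection_sym : reflection^T = reflection.
  by rewrite linearB/= linearZ/= trmx1 trmx_mul trmxK.
have outer_sqr : v^T *m v *m (v^T *m v) = s *: (v^T *m v).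
  by rewrite mulmxA -(mulmxA v^T) mulmx_tr_dotv mul_mx_scalar scalemxAl.
exists reflection.
  rewrite reflection_sym mulmxBr mulmx1 mulmxBl mul1mx -scalemxAl -scalemxAr.
  rewrite outer_sqr !scalerA (_ : 2 / s * (2 / s) * s = 2 / s + 2 / s).
    by rewrite scalerDl opprB addrK subrK.
  by field.
rewrite mulmxBr mulmx1 -scalemxAr mulmxA mulmx_tr_dotv mul_scalar_mx scalerA dotv_xv.
by rewrite (_ : 2 / s * (s / 2) = 1) ?scale1r ?subKr//; field.
Qed.

Lemma continuous_dotv x : continuous (fun z => dotv z x).
Proof.
apply: continuous_big => [|i _ z]; first exact: add_continuous.
by apply: continuousM; [exact: coord_continuous|exact: cst_continuous].
Qed.

Lemma continuous_sqnorm : continuous (fun z => sqnorm z).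
Proof.
apply: continuous_big => [|i _ z]; first exact: add_continuous.
by apply: continuousM; exact: coord_continuous.
Qed.

Lemma open_dotv_gt (t : R) x : open [set z | t < dotv z x].
Proof. by have /continuousP/(_ _ (@open_gt _ t)) := @continuous_dotv x. Qed.

Lemma closed_Cap (gamma : R) x : closed (Cap gamma x).
Proof.
by have /continuous_closedP/(_ _ (@closed_ge _ gamma)) := @continuous_dotv x.
Qed.

Lemma closed_Ssphere : closed (@Ssphere R d).
Proof. by have /continuous_closedP/(_ _ (@closed_eq _ 1)) := continuous_sqnorm. Qed.

Lemma compact_Ssphere : compact (@Ssphere R d).
Proof.
apply: bounded_closed_compact.
- exists 1; split=> // M M_gt1 z /= z1; rewrite [leLHS]mx_normrE.
  apply: bigmax_le => [|[i j] _ /=]; first lra.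
  rewrite (le_trans _ (ltW M_gt1))// ord1 -(@expr_le1 _ 2%N)// real_normK ?num_real//.
  by rewrite -z1 coord_sqr_le_sqnorm.
- exact: closed_Ssphere.
Qed.

End EuclideanGeometry.

Lemma probability_ae_ex (R : realType) (dO : measure_display)
    (Omega : measurableType dO) (P : probability Omega R) (Q : set Omega) :
  {ae P, forall w, Q w} -> exists w, Q w.
Proof.
have ae_proper : ProperFilter (almost_everywhere P).
  by apply: ae_properfilter_algebraOfSetsType; rewrite [ltRHS]probability_setT.
exact: filter_ex.
Qed.

Section RandomVector.
Context {R : realType} {d : nat} {dO : measure_display} {Omega : measurableType dO}.
Implicit Types (V : Omega -> 'rV[R]_d) (x : 'rV[R]_d).

Lemma measurable_rv_continuous V (f : 'rV[R]_d -> R) :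
  rv_measurable V -> continuous f -> measurable_fun setT (f \o V).
Proof.
move=> mV /continuousP cf; apply: (measurability _ (RGenOpens.measurableE R)).
move=> _ [_ [a [b ->] <-]]; rewrite setTI comp_preimage; apply: mV.
by apply: sub_sigma_algebra; apply/cf/interval_open.
Qed.

Lemma measurable_rv_coord V (i : 'I_d) :
  rv_measurable V -> measurable_fun setT (fun w => V w 0 i).
Proof.
move=> mV; apply: (measurable_rv_continuous mV (f := fun u => u 0 i)).
exact: coord_continuous.
Qed.

Lemma measurable_rv_dotv V x :
  rv_measurable V -> measurable_fun setT (fun w => dotv (V w) x).
Proof. by move=> mV; exact: measurable_rv_continuous mV (@continuous_dotv _ _ x). Qed.

Lemma measurable_rv_sqnormZB V (k : R) x :
  rv_measurable V -> measurable_fun setT (fun w => sqnorm (k *: V w - x)).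
Proof.
move=> mV; under eq_fun do rewrite sqnormZB.
apply: measurable_funD => //; apply: measurable_funB; apply: measurable_funM => //.
  exact: measurable_rv_continuous mV continuous_sqnorm.
exact: measurable_rv_dotv.
Qed.

Lemma borelRd_closed (A : set 'rV[R]_d) : closed A -> borelRd A.
Proof.
move=> closedA; rewrite -[A]setCK; apply: sigma_algebraC.
by apply: sub_sigma_algebra; exact: closed_openC.
Qed.

Lemma borelRd_Cap (gamma : R) x : borelRd (Cap gamma x).
Proof. by apply: borelRd_closed; exact: closed_Cap. Qed.

Lemma measurable_preimage_Cap V (gamma : R) x :
  rv_measurable V -> measurable (V @^-1` Cap gamma x).
Proof. by move=> mV; apply: mV; exact: borelRd_Cap. Qed.

Lemma measurable_mem_Cap V (gamma : R) x :
  rv_measurable V -> measurable_fun setT (fun w => gamma <= dotv (V w) x).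
Proof. by move=> mV; apply: measurable_fun_ler => //; exact: measurable_rv_dotv. Qed.

Lemma mem_preimage_Cap V (gamma : R) x w :
  (w \in V @^-1` Cap gamma x) = (gamma <= dotv (V w) x).
Proof. by apply/idP/idP => [/set_mem|cap_w]; last exact/mem_set. Qed.

Lemma unif_sphere_ae (P : probability Omega R) V :
  unif_sphere P V -> {ae P, forall w, sqnorm (V w) = 1}.
Proof.
move=> [mV V1 _]; have mS := mV _ (borelRd_closed closed_Ssphere).
exists (~` (V @^-1` @Ssphere R d)); split => //; first exact: measurableC.
by rewrite probability_setC// V1 subee.
Qed.

End RandomVector.

Section CapProbability.
Context {R : realType} {d : nat} {dO : measure_display} {Omega : measurableType dO}
  (P : probability Omega R) (V : Omega -> 'rV[R]_d).
Hypothesis unifV : unif_sphere P V.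
Implicit Types x y : 'rV[R]_d.

Let mV : rv_measurable V. Proof. by case: unifV. Qed.

Lemma Cap_probability_const (gamma : R) x y : sqnorm x = 1 -> sqnorm y = 1 ->
  P (V @^-1` Cap gamma x) = P (V @^-1` Cap gamma y).
Proof.
move=> x1 y1; have [Q QQ yQ] := orthogonal_transitive (etrans y1 (esym x1)).
have [_ _ /(_ Q QQ _ (borelRd_Cap gamma x)) ->] := unifV; congr (P _).
by apply/seteqP; split=> w; rewrite /Cap/= dotv_mulmx -yQ -mulmxA QQ mulmx1.
Qed.

(* Finitely many congruent caps cover the sphere. *)
Lemma Cap_probability_gt0 (gamma : R) x : gamma < 1 -> sqnorm x = 1 ->
  (0 < P (V @^-1` Cap gamma x))%E.
Proof.
move=> gamma_lt1 x1; rewrite lt_neqAle measure_ge0 andbT.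
apply/negP => /eqP/esym Px0; have := @compact_Ssphere R d.
rewrite compact_cover => /(_ _ (@Ssphere R d) (fun y => [set z | gamma < dotv z y])).
case=> [y _|z z1|ys ys1 cover_ys]; first exact: open_dotv_gt.
  by exists z => //=; rewrite -/(sqnorm z) z1.
have avoids_cover :
    almost_everywhere P (\bigcap_(y in [set` ys]) ~` (V @^-1` Cap gamma y)).
  apply: filter_bigI => y y_ys; exists (V @^-1` Cap gamma y).
  split; [exact: measurable_preimage_Cap | | by rewrite setCK].
  by rewrite (Cap_probability_const _ _ x1)//; have := ys1 y y_ys; rewrite inE.
have [w [Vw1 avoids]] :=
  probability_ae_ex (filterI (unif_sphere_ae unifV) avoids_cover).
have [y y_ys /ltW gamma_le] := cover_ys _ Vw1.
exact: avoids y y_ys gamma_le.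
Qed.

Lemma Cap_probability_lt1 (gamma : R) x : -1 < gamma -> sqnorm x = 1 ->
  (P (V @^-1` Cap gamma x) < 1)%E.
Proof.
move=> gamma_gt x1; have xN1 : sqnorm (- x) = 1 by rewrite sqnormN.
pose opposite := V @^-1` Cap ((1 - gamma) / 2) (- x).
have opposite_gt0 : (0 < P opposite)%E by apply: Cap_probability_gt0 => //; lra.
have mopposite : measurable opposite by exact: measurable_preimage_Cap.
apply: (@le_lt_trans _ _ (P (~` opposite))).
  apply: le_measure; rewrite ?inE.
  - exact: measurable_preimage_Cap.
  - exact: measurableC.
  - by move=> w; rewrite /opposite /Cap/= dotvNr => ? ?; lra.
by rewrite probability_setC// lteBlDr ?fin_num_measure// lteDl.
Qed.

End CapProbability.

Section CapFubini.
Context {R : realType} {d : nat} (gamma : R)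
  {d1 d2 : measure_display} {O1 : measurableType d1} {O2 : measurableType d2}
  (P1 : probability O1 R) (P2 : probability O2 R)
  (U : O1 -> 'rV[R]_d) (Z : O2 -> 'rV[R]_d).

Definition cap_pairs : set (O1 * O2) := [set w | gamma <= dotv (U w.1) (Z w.2)].

Lemma measurable_cap_pairs : rv_measurable U -> rv_measurable Z ->
  measurable cap_pairs.
Proof.
move=> mU mZ; rewrite -[cap_pairs]setTI.
have : measurable_fun setT (fun w : O1 * O2 => gamma <= dotv (U w.1) (Z w.2)).
  apply: measurable_fun_ler => //; apply: measurable_sum => i.
  apply: measurable_funM.
    by apply: (measurableT_comp (measurable_rv_coord i mU)).
  by apply: (measurableT_comp (measurable_rv_coord i mZ)).
by move=> /(_ measurableT [set true] I).
Qed.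

Lemma xsection_cap_pairs w : xsection cap_pairs w = Z @^-1` Cap gamma (U w).
Proof.
by apply/seteqP; split=> v /=; rewrite /xsection/= inE /cap_pairs /Cap/= dotvC.
Qed.

Lemma ysection_cap_pairs v : ysection cap_pairs v = U @^-1` Cap gamma (Z v).
Proof. by apply/seteqP; split=> w /=; rewrite /ysection/= inE /cap_pairs /Cap/=. Qed.

Lemma Cap_probability_fubini : rv_measurable U -> rv_measurable Z ->
  (\int[P1]_w P2 (Z @^-1` Cap gamma (U w)) =
   \int[P2]_v P1 (U @^-1` Cap gamma (Z v)))%E.
Proof.
move=> mU mZ; have mpairs := measurable_cap_pairs mU mZ.
have := indic_fubini_tonelli P1 P2 mpairs.
rewrite indic_fubini_tonelli_FE// indic_fubini_tonelli_GE//=.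
under eq_integral do rewrite xsection_cap_pairs.
by under [RHS]eq_integral do rewrite ysection_cap_pairs.
Qed.

Lemma Cap_probability_mean (x : 'rV[R]_d) :
  unif_sphere P1 U -> unif_sphere P2 Z -> sqnorm x = 1 ->
  (\int[P1]_w P2 (Z @^-1` Cap gamma (U w)) = P2 (Z @^-1` Cap gamma x))%E.
Proof.
move=> unifU unifZ x1; have [[mU _ _] [mZ _ _]] := (unifU, unifZ).
transitivity (\int[P1]_w cst (P2 (Z @^-1` Cap gamma x)) w)%E; last first.
  by rewrite integral_cst//= probability_setT mule1.
apply: ae_eq_integral => //.
  have := measurable_fun_xsection P2 (measurable_cap_pairs mU mZ).
  by apply: eq_measurable_fun => w _ /=; rewrite xsection_cap_pairs.
apply: filterS (unif_sphere_ae unifU) => w Uw1 _.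
by rewrite /= (Cap_probability_const unifZ gamma Uw1 x1).
Qed.

End CapFubini.

Lemma Cap_probability_unique (R : realType) (d : nat) (gamma : R)
    (d1 d2 : measure_display) (O1 : measurableType d1) (O2 : measurableType d2)
    (P1 : probability O1 R) (P2 : probability O2 R)
    (U : O1 -> 'rV[R]_d) (Z : O2 -> 'rV[R]_d) (x : 'rV[R]_d) :
  unif_sphere P1 U -> unif_sphere P2 Z -> sqnorm x = 1 ->
  P1 (U @^-1` Cap gamma x) = P2 (Z @^-1` Cap gamma x).
Proof.
move=> unifU unifZ x1; have [[mU _ _] [mZ _ _]] := (unifU, unifZ).
rewrite -(Cap_probability_mean gamma unifU unifZ x1) Cap_probability_fubini//.
by rewrite (Cap_probability_mean gamma unifZ unifU x1).
Qed.

Section Bienayme.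
Local Open Scope ereal_scope.
Context {R : realType} {dO : measure_display} {Omega : measurableType dO}
  (P : probability Omega R).
Implicit Types (X Y : Omega -> R) (A B : set Omega).

Lemma Lfun_bounded X (M r : R) : (0 <= r)%R -> measurable_fun setT X ->
  (forall w, `|X w| <= M)%R -> X \in Lfun P r%:E.
Proof.
move=> r_ge0 mX XM; rewrite inE/=; apply/andP; split; rewrite inE//=.
rewrite /finite_norm unlock poweR_lty//.
apply: (@le_lt_trans _ _ (\int[P]_w (M `^ r)%:E)); last first.
  by rewrite integral_cst//= probability_setT mule1 ltry.
apply: ge0_le_integral => //.
- by move=> w _; rewrite lee_fin powR_ge0.
- apply/measurable_EFinP/(measurableT_comp (measurable_powR r)).
  exact: measurableT_comp.
- move=> w _; rewrite lee_fin ge0_ler_powR ?nnegrE//.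
  exact: le_trans (XM w).
Qed.

Lemma Lfun2_normr X : X \in Lfun P 2%:E -> Num.norm \o X \in Lfun P 2%:E.
Proof.
case/andP; rewrite !inE/= => mX X2; apply/andP; split; rewrite inE/=.
  exact: measurableT_comp.
rewrite /finite_norm; under [X in 'N[_]__[X]]eq_fun => w do rewrite -abse_EFin.
by rewrite Lnorm_abse.
Qed.

Lemma covariance_sumr (I : Type) (s : seq I) (X : I -> Omega -> R) Y :
  Y \in Lfun P 2%:E -> (forall i, X i \in Lfun P 2%:E) ->
  covariance P Y (\sum_(i <- s) X i)%R = \sum_(i <- s) covariance P Y (X i).
Proof.
move=> Y2 X2; elim: s => [|i s IHs]; first by rewrite !big_nil covariance_cst_r.
by rewrite !big_cons covarianceDr ?IHs// rpred_sum ?lee1n.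
Qed.

Lemma variance_sum_uncorrelated (I : eqType) (s : seq I) (X : I -> Omega -> R) :
  uniq s -> (forall i, X i \in Lfun P 2%:E) ->
  (forall i j, i != j -> covariance P (X i) (X j) = 0) ->
  'V_P[(\sum_(i <- s) X i)%R] = \sum_(i <- s) 'V_P[X i].
Proof.
move=> + X2 X_uncor; elim: s => [_|i s IHs /= /andP[i_s s_uniq]].
  by rewrite !big_nil variance_cst.
have X_uncor_sum : covariance P (X i) (\sum_(j <- s) X j)%R = 0.
  rewrite covariance_sumr// big_seq big1// => j j_s.
  by apply: X_uncor; apply: contraNneq i_s => ->.
by rewrite !big_cons varianceD ?rpred_sum ?lee1n// X_uncor_sum mule0 adde0 IHs.
Qed.

Lemma Lfun_indic A (r : R) : (0 <= r)%R -> measurable A -> \1_A \in Lfun P r%:E.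
Proof.
move=> r_ge0 mA; apply: (Lfun_bounded (M := 1)) => // w.
by rewrite indicE; case: (_ \in _); rewrite ?normr0 ?normr1.
Qed.

Lemma covariance_indic A B : measurable A -> measurable B ->
  covariance P \1_A \1_B = P (A `&` B) - P A * P B.
Proof.
move=> mA mB; have AB : (\1_A * \1_B = \1_(A `&` B) :> (Omega -> R))%R.
  by rewrite indicI.
rewrite covarianceE ?AB ?expectation_indic//; try exact: Lfun_indic.
- exact: measurableI.
- exact/Lfun_indic/measurableI.
Qed.

Lemma expectation_deviation_le X : X \in Lfun P 2%:E ->
  'E_P[fun w => `|X w - fine 'E_P[X]|%R] <= sqrte 'V_P[X].
Proof.
move=> X2; pose Y := (X \- cst (fine 'E_P[X]))%R.
have Y2 : Y \in Lfun P 2%:E by rewrite rpredB ?lee1n//= Lfun_cst.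
have varX : 'V_P[X] = 'E_P[(Num.norm \o Y) ^+ 2].
  rewrite /variance covariance.unlock; congr 'E_P[_]; apply/funext => w.
  by rewrite -/Y expr2 !fctE/= -normrM ger0_norm// -expr2 sqr_ge0.
have absY2 := Lfun2_normr Y2.
have absY_fin : 'E_P[Num.norm \o Y] \is a fin_num.
  by rewrite expectation_fin_num// Lfun_subset12 ?fin_num_measure.
have := variance_ge0 P (Num.norm \o Y).
rewrite varianceE// -varX sube_ge0 ?fin_numX// => sqr_le.
by rewrite lee_sqrE ?sqrte_ge0// sqr_sqrte ?variance_ge0.
Qed.

End Bienayme.

Section EmpiricalFrequency.
Context {R : realType} {dO : measure_display} {Omega : measurableType dO}
  (P : probability Omega R) {N : nat} (A : 'I_N -> set Omega) (p : R).
Hypothesis mA : forall k, measurable (A k).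
Hypothesis P_A : forall k, P (A k) = p%:E.

Definition empirical_frequency (w : Omega) : R := (\sum_(k < N) \1_(A k) w) / N%:R.

Lemma empirical_frequencyE :
  empirical_frequency = N%:R^-1 \o* (\sum_(k < N) (\1_(A k) : Omega -> R)).
Proof. by apply/funext => w; rewrite /empirical_frequency fct_sumE. Qed.

Lemma Lfun_sum_indic (r : R) : 1 <= r ->
  \sum_(k < N) (\1_(A k) : Omega -> R) \in Lfun P r%:E.
Proof.
move=> r_ge1; rewrite rpred_sum ?lee_fin//.
by move=> k _; apply: Lfun_indic => //; exact: le_trans r_ge1.
Qed.

Lemma expectation_empirical_frequency : (0 < N)%N ->
  ('E_P[empirical_frequency] = p%:E)%E.
Proof.
move=> N_gt0; rewrite empirical_frequencyE expectationZl ?Lfun_sum_indic//.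
rewrite -(big_map (fun k => \1_(A k) : Omega -> R) xpredT id) expectation_sum.
  rewrite big_map (eq_bigr (fun=> p%:E)) => [|k _]; last by rewrite expectation_indic.
  by rewrite sumEFin sumr_const card_ord -EFinM -(mulr_natl p) mulKf// pnatr_eq0 -lt0n.
by move=> _ /mapP[k _ ->]; exact: Lfun_indic.
Qed.

Lemma variance_empirical_frequency :
  (forall j k, j != k -> P (A j `&` A k) = (p ^+ 2)%:E) ->
  ('V_P[empirical_frequency] = (p * (1 - p) / N%:R)%:E)%E.
Proof.
move=> A_indep; rewrite empirical_frequencyE varianceZ ?Lfun_sum_indic ?ler1n//.
rewrite variance_sum_uncorrelated ?index_enum_uniq//.
- rewrite (eq_bigr (fun=> (p - p * p)%:E)) => [|k _]; last first.
    by rewrite /variance covariance_indic// setIid P_A.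
  rewrite sumEFin sumr_const card_ord -EFinM -(mulr_natl (p - p * p)); congr _%:E.
  have [->|N_neq0] := eqVneq (N%:R : R) 0; first by rewrite mul0r invr0 !mulr0.
  by field; exact: N_neq0.
- by move=> k; exact: Lfun_indic.
- move=> j k jk; rewrite covariance_indic// A_indep// !P_A.
  by rewrite -EFinM -EFinB -expr2 subrr.
Qed.

End EmpiricalFrequency.

Lemma measurable_inv (R : realType) : measurable_fun setT (fun t : R => t^-1).
Proof.
rewrite (_ : (fun t : R => t^-1) = fun t => t * (t ^+ 2) `^ (-1)).
  by apply: measurable_funM => //; apply: (measurableT_comp (measurable_powR _)).
apply/funext => t; rewrite powR_inv1 ?sqr_ge0//.
by have [->|t_neq0] := eqVneq t 0; [rewrite invr0 mul0r | field].
Qed.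

Lemma mutually_indep_pair (R : realType) (d N : nat) (dO : measure_display)
    (Omega : measurableType dO) (P : probability Omega R)
    (Z : 'I_N -> Omega -> 'rV[R]_d) (A B : set 'rV[R]_d) (j k : 'I_N) :
  mutually_indep P Z -> borelRd A -> borelRd B -> j != k ->
  Prob P (Z j @^-1` A `&` Z k @^-1` B) =
  Prob P (Z j @^-1` A) * Prob P (Z k @^-1` B).
Proof.
move=> indep bA bB jk.
have bT : borelRd [set: 'rV[R]_d] by apply: sub_sigma_algebra; exact: openT.
pose C (i : 'I_N) := if i == j then A else if i == k then B else setT.
have /indep : forall i, borelRd (C i).
  by move=> i; rewrite /C; case: ifP => // _; case: ifP.
have Cj : C j = A by rewrite /C eqxx.
have Ck : C k = B by rewrite /C eq_sym (negbTE jk) eqxx.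
rewrite (_ : [set w | _] = Z j @^-1` A `&` Z k @^-1` B); last first.
  apply/seteqP; split=> [w Cw | w [Aj Bk] i] /=.
    by split; [have := Cw j; rewrite Cj | have := Cw k; rewrite Ck].
  by rewrite /C; case: eqP => [->//|_]; case: eqP => [->|].
move=> ->; rewrite (bigD1 j)//= (bigD1 k) 1?eq_sym//= big1 ?mulr1 ?Cj ?Ck//.
move=> i /andP[/negbTE ij /negbTE ik]; rewrite /C ij ik preimage_setT.
by rewrite /Prob probability_setT.
Qed.

Section CapFraction.
Context {R : realType} {d N : nat}.
Implicit Types (gamma : R) (x : 'rV[R]_d) (zs : 'I_N -> 'rV[R]_d).

Definition cap_fraction gamma x zs : R :=
  (\sum_(k < N) (if gamma <= dotv (zs k) x then 1 else 0)) / N%:R.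

Variables (gamma : R) (x : 'rV[R]_d) (zs : 'I_N -> 'rV[R]_d).
Hypothesis N_gt0 : (0 < N)%N.

Local Notation in_cap k := (gamma <= dotv (zs k) x).
Local Notation theta := (cap_fraction gamma x zs).

Lemma sum_if_cap (u v : R) :
  \sum_(k < N) (if in_cap k then u else v) = N%:R * (theta * u + (1 - theta) * v).
Proof.
have N_neq0 : N%:R != 0 :> R by rewrite pnatr_eq0 -lt0n.
have Nv : N%:R * v = \sum_(k < N) v by rewrite sumr_const card_ord mulr_natl.
have -> : N%:R * (theta * u + (1 - theta) * v) =
    (\sum_(k < N) (if in_cap k then 1 else 0)) * (u - v) + N%:R * v.
  by rewrite /cap_fraction; field; exact: N_neq0.
rewrite Nv mulr_suml -big_split/=; apply: eq_bigr => k _.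
by case: ifP => _; ring.
Qed.

Lemma cap_fraction_ge0 : 0 <= theta.
Proof. by rewrite divr_ge0// sumr_ge0// => k _; case: ifP. Qed.

Lemma onem_cap_fraction :
  1 - theta = (\sum_(k < N) (if in_cap k then 0 else 1)) / N%:R.
Proof.
by rewrite sum_if_cap mulr0 add0r mulr1 mulrC mulKf// pnatr_eq0 -lt0n.
Qed.

Lemma cap_fraction_le1 : theta <= 1.
Proof.
by rewrite -subr_ge0 onem_cap_fraction divr_ge0// sumr_ge0// => k _; case: ifP.
Qed.

Lemma cap_fraction_gt0 k : in_cap k -> 0 < theta.
Proof.
move=> in_k; rewrite divr_gt0 ?ltr0n// (bigD1 k)//= in_k ltr_pwDl//.
by apply: sumr_ge0 => j _; case: ifP.
Qed.

Lemma cap_fraction_lt1 k : ~~ in_cap k -> theta < 1.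
Proof.
move=> /negbTE out_k; rewrite -subr_gt0 onem_cap_fraction divr_gt0 ?ltr0n//.
rewrite (bigD1 k)//= out_k ltr_pwDl//.
by apply: sumr_ge0 => j _; case: ifP.
Qed.

End CapFraction.

Lemma measurable_cap_fraction (R : realType) (d N : nat) (dO : measure_display)
    (Omega : measurableType dO) (Z : 'I_N -> Omega -> 'rV[R]_d) (gamma : R)
    (x : 'rV[R]_d) : (forall k, rv_measurable (Z k)) ->
  measurable_fun setT (fun w => cap_fraction gamma x (Z ^~ w)).
Proof.
move=> mZ; apply: measurable_funM => //; apply: measurable_sum => k.
by apply: measurable_fun_ifT => //; exact: measurable_mem_Cap.
Qed.

Lemma measurable_pu_density (R : realType) (d : nat) (dO : measure_display)
    (Omega : measurableType dO) (V : Omega -> 'rV[R]_d) (gamma p0 thb : R)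
    (x : 'rV[R]_d) : rv_measurable V ->
  measurable_fun setT (fun w => pu_density gamma p0 thb x (V w)).
Proof.
by move=> mV; apply: measurable_fun_ifT => //; exact: measurable_mem_Cap.
Qed.

Section CapWeights.
Context {R : realType} (p0 thb : R).
Hypothesis p0_01 : 0 <= p0 <= 1.
Hypothesis thb_01 : 0 < thb < 1.

Let thb_gt0 : 0 < thb. Proof. by case/andP: thb_01. Qed.
Let thb_lt1 : thb < 1. Proof. by case/andP: thb_01. Qed.

Lemma c1_ge0 : 0 <= c1 p0 thb.
Proof. by case/andP: p0_01 => p0_ge0 _; rewrite divr_ge0// ltW. Qed.

Lemma c2_ge0 : 0 <= c2 p0 thb.
Proof. by case/andP: p0_01 => _ p0_le1; rewrite divr_ge0 ?subr_ge0// ltW. Qed.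

Lemma mulr_c1 : thb * c1 p0 thb = p0.
Proof. by rewrite mulrC divfK// gt_eqF. Qed.

Lemma mulr_c2 : (1 - thb) * c2 p0 thb = 1 - p0.
Proof. by rewrite mulrC divfK// subr_eq0 gt_eqF. Qed.

Lemma pu_density_ge0 d gamma (x z : 'rV[R]_d) : 0 <= pu_density gamma p0 thb x z.
Proof.
by rewrite /pu_density; case: ifP => _; [exact: c1_ge0 | exact: c2_ge0].
Qed.

(* The probability that MMRC outputs a cap candidate, when a fraction [theta]
   of the candidates lies in the cap. *)
Definition mmrc_cap_mass (theta : R) : R :=
  if theta <= thb then theta * c1 p0 thb else 1 - (1 - theta) * c2 p0 thb.

Lemma mmrc_cap_mass0 : mmrc_cap_mass 0 = 0.
Proof. by rewrite /mmrc_cap_mass ltW// mul0r. Qed.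

Lemma mmrc_cap_mass1 : mmrc_cap_mass 1 = 1.
Proof. by rewrite /mmrc_cap_mass leNgt thb_lt1/= subrr mul0r subr0. Qed.

Lemma off_cap_mass_le theta : thb < theta -> (1 - theta) * c2 p0 thb <= 1 - p0.
Proof.
by move=> theta_gt; rewrite -mulr_c2 ler_wpM2r ?c2_ge0// lerD2l lerN2 ltW.
Qed.

Lemma mmrc_cap_mass_bounds theta : 0 <= theta <= 1 -> 0 <= mmrc_cap_mass theta <= 1.
Proof.
move=> /andP[theta_ge0 theta_le1]; have := p0_01; rewrite /mmrc_cap_mass.
have [theta_le|/off_cap_mass_le off_le] := leP theta thb => p0_bounds.
  have : theta * c1 p0 thb <= p0 by rewrite -[leRHS]mulr_c1 ler_wpM2r ?c1_ge0.
  have : 0 <= theta * c1 p0 thb by rewrite mulr_ge0 ?c1_ge0.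
  by lra.
have : 0 <= (1 - theta) * c2 p0 thb by rewrite mulr_ge0 ?c2_ge0 ?subr_ge0.
by lra.
Qed.

Lemma measurable_mmrc_cap_mass : measurable_fun setT mmrc_cap_mass.
Proof.
apply: measurable_fun_ifT; first exact: measurable_fun_ler.
  exact: measurable_funM.
by apply: measurable_funB => //; apply: measurable_funM => //; exact: measurable_funB.
Qed.

Lemma mmrc_cap_mass_ge theta :
  p0 - c1 p0 thb * `|theta - thb| <= mmrc_cap_mass theta.
Proof.
rewrite /mmrc_cap_mass; have [theta_le|/off_cap_mass_le off_le] := leP theta thb.
  rewrite distrC ger0_norm ?subr_ge0// -[X in X - _]mulr_c1.
  by rewrite mulrBr opprB addrCA [c1 _ _ * thb]mulrC subrr addr0 mulrC.
have : 0 <= c1 p0 thb * `|theta - thb| by rewrite mulr_ge0 ?c1_ge0.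
by lra.
Qed.

Context {d N : nat} (gamma : R) (x : 'rV[R]_d).
Hypothesis N_gt0 : (0 < N)%N.
Implicit Type zs : 'I_N -> 'rV[R]_d.

Local Notation theta zs := (cap_fraction gamma x zs).
Local Notation pi zs := (pi_mmrc gamma p0 thb x zs).
Local Notation in_cap zs k := (gamma <= dotv (zs k) x).

Lemma pi_mmrcE zs k : pi zs k =
  if in_cap zs k then mmrc_cap_mass (theta zs) / (N%:R * theta zs)
  else (1 - mmrc_cap_mass (theta zs)) / (N%:R * (1 - theta zs)).
Proof.
have mixture : thb * c1 p0 thb + (1 - thb) * c2 p0 thb = 1.
  by rewrite mulr_c1 mulr_c2; ring.
have N_neq0 : N%:R != 0 :> R by rewrite pnatr_eq0 -lt0n.
rewrite /pi_mmrc -/(theta zs) mixture /mmrc_cap_mass.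
have [in_k|out_k] := boolP (in_cap zs k).
- have := cap_fraction_gt0 N_gt0 in_k.
  set th := theta zs => /lt0r_neq0 th_neq0.
  have [lt|gt|->] := ltrgtP th thb.
  + by field; rewrite N_neq0 th_neq0.
  + by congr (_ / _); field.
  + by rewrite mixture; field; rewrite N_neq0 gt_eqF.
- have := cap_fraction_lt1 N_gt0 out_k.
  set th := theta zs; rewrite -subr_gt0 => /lt0r_neq0 th_neq1.
  have [lt|gt|->] := ltrgtP th thb.
  + by congr (_ / _); field.
  + by field; rewrite N_neq0 th_neq1.
  + by rewrite mixture mulr_c1 -mulr_c2; field; rewrite N_neq0 subr_eq0 gt_eqF.
Qed.

Lemma pi_mmrc_ge0 zs k : 0 <= pi zs k.
Proof.
have th_ge0 := cap_fraction_ge0 gamma x zs.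
have th_le1 := cap_fraction_le1 gamma x zs N_gt0.
have /andP[mass_ge0 mass_le1] : 0 <= mmrc_cap_mass (theta zs) <= 1.
  by rewrite mmrc_cap_mass_bounds ?th_ge0.
rewrite pi_mmrcE; case: ifP => _.
- by rewrite divr_ge0 ?(mulr_ge0 (ler0n _ _)).
- by rewrite divr_ge0 ?(mulr_ge0 (ler0n _ _)) ?subr_ge0.
Qed.

Lemma sum_pi_mmrc zs (u v : R) :
  \sum_(k < N) pi zs k * (if in_cap zs k then u else v) =
  mmrc_cap_mass (theta zs) * u + (1 - mmrc_cap_mass (theta zs)) * v.
Proof.
have N_neq0 : N%:R != 0 :> R by rewrite pnatr_eq0 -lt0n.
rewrite (eq_bigr (fun k => if in_cap zs k
    then mmrc_cap_mass (theta zs) / (N%:R * theta zs) * u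
    else (1 - mmrc_cap_mass (theta zs)) / (N%:R * (1 - theta zs)) * v)); last first.
  by move=> k _; rewrite pi_mmrcE; case: ifP.
rewrite sum_if_cap//; set th := theta zs.
have [->|th_neq0] := eqVneq th 0.
  by rewrite mmrc_cap_mass0 !(mul0r, add0r, subr0, mulr1, mul1r) mulVKf.
have [->|th_neq1] := eqVneq th 1.
  by rewrite mmrc_cap_mass1 !(mul0r, addr0, subrr, mulr1, mul1r) mulVKf.
by field; rewrite N_neq0 th_neq0 subr_eq0 eq_sym th_neq1.
Qed.

Lemma measurable_pi_mmrc (dO : measure_display) (Omega : measurableType dO)
    (Z : 'I_N -> Omega -> 'rV[R]_d) k : (forall j, rv_measurable (Z j)) ->
  measurable_fun setT (fun w => pi (Z ^~ w) k).
Proof.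
move=> mZ; under eq_fun do rewrite pi_mmrcE.
have minc j := measurable_mem_Cap gamma x (mZ j).
have mtheta := measurable_cap_fraction gamma x mZ.
have mmass := measurableT_comp measurable_mmrc_cap_mass mtheta.
have mratio (u v : Omega -> R) : measurable_fun setT u -> measurable_fun setT v ->
    measurable_fun setT (fun w => u w / (N%:R * v w)).
  move=> mu mv; apply: measurable_funM => //.
  by apply: (measurableT_comp (@measurable_inv R)); exact: measurable_funM.
by apply: measurable_fun_ifT => //; apply: mratio => //; exact: measurable_funB.
Qed.

End CapWeights.

Lemma scaled_bernoulli_std_le (R : realType) (a e loss p n : R) :
  0 <= a <= e -> 0 <= loss -> 0 < n -> e ^+ 2 <= n * loss ^+ 2 ->
  a * Num.sqrt (p * (1 - p) / n) <= loss.
Proof.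
move=> /andP[a_ge0 a_le] loss_ge0 n_gt0 e_le.
have var_le1 : p * (1 - p) <= 1 by have := sqr_ge0 (p - 1 / 2); lra.
rewrite -[X in X * _](ger0_norm a_ge0) -[leRHS](ger0_norm loss_ge0) -!sqrtr_sqr.
rewrite -sqrtrM ?sqr_ge0// ler_wsqrtr// mulrA ler_pdivrMr// [leRHS]mulrC.
apply: le_trans e_le; apply: (@le_trans _ _ (a ^+ 2)).
  by rewrite ler_piMr ?sqr_ge0.
by rewrite lerXn2r// nnegrE (le_trans a_ge0).
Qed.

Section MmrcCapProbability.
Context {R : realType} {d N : nat} {dO : measure_display}
  {Omega : measurableType dO} (P : probability Omega R)
  (Z : 'I_N -> Omega -> 'rV[R]_d) (gamma p0 thb : R) (x : 'rV[R]_d).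

Definition mmrc_cap_probability : R :=
  fine (\int[P]_w (\sum_(k < N) pi_mmrc gamma p0 thb x (fun j => Z j w) k
                    * (if gamma <= dotv (Z k w) x then 1 else 0))%:E).

Hypothesis N_gt0 : (0 < N)%N.
Hypothesis p0_01 : 0 <= p0 <= 1.
Hypothesis thb_01 : 0 < thb < 1.
Hypothesis mZ : forall k, rv_measurable (Z k).
Hypothesis indepZ : mutually_indep P Z.
Hypothesis P_Cap : forall k, P (Z k @^-1` Cap gamma x) = thb%:E.

Local Notation capped k := (Z k @^-1` Cap gamma x).
Local Notation theta w := (cap_fraction gamma x (Z ^~ w)).

Lemma cap_fraction_frequency w :
  theta w = empirical_frequency (fun k => capped k) w.
Proof.
congr (_ / _); apply: eq_bigr => k _; rewrite indicE mem_preimage_Cap.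
by case: ifP.
Qed.

Lemma probability_capped_pair j k : j != k -> P (capped j `&` capped k) = (thb ^+ 2)%:E.
Proof.
move=> jk; have mcap i : measurable (capped i) by exact: measurable_preimage_Cap.
have := mutually_indep_pair indepZ (borelRd_Cap gamma x) (borelRd_Cap gamma x) jk.
rewrite /Prob !P_Cap/= expr2 => <-; rewrite fineK// fin_num_measure//.
exact: measurableI.
Qed.

Lemma expectation_cap_deviation_le :
  ('E_P[fun w => `|theta w - thb|%R] <= (Num.sqrt (thb * (1 - thb) / N%:R))%:E)%E.
Proof.
have mcap k : measurable (capped k) by exact: measurable_preimage_Cap.
under eq_fun do rewrite cap_fraction_frequency.
have freq2 : empirical_frequency (fun k => capped k) \in Lfun P 2%:E.
  by rewrite empirical_frequencyE Lfun_scale ?Lfun_sum_indic ?ler1n.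
have := expectation_deviation_le freq2.
rewrite (variance_empirical_frequency mcap P_Cap probability_capped_pair).
by rewrite (expectation_empirical_frequency mcap P_Cap N_gt0).
Qed.

Lemma mmrc_cap_probabilityE :
  mmrc_cap_probability = fine 'E_P[fun w => mmrc_cap_mass p0 thb (theta w)].
Proof.
rewrite /mmrc_cap_probability expectation.unlock; congr fine.
apply: eq_integral => w _.
by rewrite (sum_pi_mmrc p0 thb_01 gamma x N_gt0) mulr1 mulr0 addr0.
Qed.

Lemma mmrc_cap_probability_ge :
  p0 - c1 p0 thb * Num.sqrt (thb * (1 - thb) / N%:R) <= mmrc_cap_probability.
Proof.
pose mass w := mmrc_cap_mass p0 thb (theta w).
pose deviation w := `|theta w - thb|.
have mtheta : measurable_fun setT (fun w => theta w).
  by apply: measurable_cap_fraction.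
have mmass : measurable_fun setT mass.
  by apply: (measurableT_comp (measurable_mmrc_cap_mass p0 thb)).
have mdeviation : measurable_fun setT deviation.
  by apply: measurableT_comp => //; exact: measurable_funB.
have theta_01 w : 0 <= theta w <= 1 by rewrite cap_fraction_ge0 cap_fraction_le1.
have mass_01 w : 0 <= mass w <= 1 by exact: mmrc_cap_mass_bounds.
have deviation_ge0 w : 0 <= deviation w by exact: normr_ge0.
have c1_ge0 := c1_ge0 p0_01 thb_01.
have massL : mass \in Lfun P 1.
  apply: (@Lfun_bounded _ _ _ _ _ 1) => // w.
  by have /andP[? ?] := mass_01 w; rewrite ger0_norm.
have deviationL : deviation \in Lfun P 1.
  apply: (@Lfun_bounded _ _ _ _ _ 1) => // w; rewrite normr_id ler_norml.
  by have := theta_01 w; have := thb_01; lra.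
have p0_le : (p0%:E <= 'E_P[mass] + (c1 p0 thb)%:E * 'E_P[deviation])%E.
  rewrite -expectationZl// -expectationD ?Lfun_scale// -(expectation_cst P p0).
  apply: expectation_le => //.
  - by apply: measurable_funD => //; exact: measurable_funM.
  - by case/andP: p0_01.
  - move=> w /=; have /andP[mass_ge0 _] := mass_01 w.
    by apply: addr_ge0 => //; exact: mulr_ge0.
  - by apply: aeW => w /=; rewrite mulrC -lerBlDr mmrc_cap_mass_ge.
rewrite mmrc_cap_probabilityE lerBlDr -lee_fin EFinD fineK ?expectation_fin_num//.
apply: le_trans p0_le _; rewrite (EFinM (c1 p0 thb)) leeD2l//.
apply: lee_wpmul2l; first by rewrite lee_fin.
exact: expectation_cap_deviation_le.
Qed.

Lemma mmrc_cap_probability_loss (e loss : R) : c1 p0 thb <= e -> 0 <= loss ->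
  e ^+ 2 <= N%:R * loss ^+ 2 -> p0 - loss <= mmrc_cap_probability.
Proof.
move=> c1_le loss_ge0 N_ge; apply: le_trans mmrc_cap_probability_ge.
rewrite lerD2l lerN2; apply: (scaled_bernoulli_std_le _ _ loss_ge0 _ N_ge).
  by rewrite c1_ge0.
by rewrite ltr0n.
Qed.

End MmrcCapProbability.

Section PrivUnitBounds.
Context {R : realType} {d : nat} {dO : measure_display}
  {Omega : measurableType dO} (P : probability Omega R)
  (U : Omega -> 'rV[R]_d) (gamma p0 : R).
Hypothesis unifU : unif_sphere P U.
Hypothesis gamma_bounds : -1 < gamma < 1.
Implicit Type x : 'rV[R]_d.

Local Notation thb x := (thetabar P U gamma x).

Let mU : rv_measurable U. Proof. by case: unifU. Qed.

Lemma thetabarE x : P (U @^-1` Cap gamma x) = (thb x)%:E.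
Proof.
by rewrite /thetabar /Prob fineK// fin_num_measure//; exact: measurable_preimage_Cap.
Qed.

Lemma thetabar_bounds x : sqnorm x = 1 -> 0 < thb x < 1.
Proof.
move=> x1; have /andP[gamma_gtN1 gamma_lt1] := gamma_bounds.
by rewrite -!lte_fin -thetabarE Cap_probability_gt0// Cap_probability_lt1.
Qed.

Definition privunit_ldp (eps : R) : Prop := forall x x' z : 'rV[R]_d,
  sqnorm x = 1 -> sqnorm x' = 1 -> sqnorm z = 1 ->
  pu_density gamma p0 (thb x) x z <= expR eps * pu_density gamma p0 (thb x') x' z.

(* Privacy at [z = x] against the input [- x] compares the density on the cap
   with the density off it, and the two average to [1]. *)
Lemma c1_le_expR eps x : privunit_ldp eps -> sqnorm x = 1 ->
  c1 p0 (thb x) <= expR eps.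
Proof.
move=> ldp x1; have thb_01 := thetabar_bounds x1.
have /andP[thb_gt0 thb_lt1] := thb_01.
have /andP[gamma_gtN1 gamma_lt1] := gamma_bounds.
have xN1 : sqnorm (- x) = 1 by rewrite sqnormN.
have thbN : thb (- x) = thb x.
  by rewrite /thetabar /Prob (Cap_probability_const unifU gamma xN1 x1).
have on_cap : pu_density gamma p0 (thb x) x x = c1 p0 (thb x).
  by rewrite /pu_density -/(sqnorm x) x1 ltW.
have off_cap : pu_density gamma p0 (thb x) (- x) x = c2 p0 (thb x).
  by rewrite /pu_density dotvNr -/(sqnorm x) x1 leNgt gamma_gtN1.
have := ldp x x x x1 x1 x1; have := ldp x (- x) x x1 xN1 x1.
rewrite thbN on_cap off_cap => c1_le_c2 c1_le_c1.
have -> : c1 p0 (thb x) = thb x * c1 p0 (thb x) + (1 - thb x) * c1 p0 (thb x).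
  by ring.
have -> : expR eps = thb x * (expR eps * c1 p0 (thb x))
    + (1 - thb x) * (expR eps * c2 p0 (thb x)).
  by rewrite !(mulrCA _ (expR eps)) -mulrDr mulr_c1// mulr_c2//; ring.
by rewrite lerD// ler_wpM2l// ltW// subr_gt0.
Qed.

Lemma integral_pu_density x : sqnorm x = 1 -> 0 <= p0 <= 1 ->
  (\int[P]_w (pu_density gamma p0 (thb x) x (U w))%:E = 1)%E.
Proof.
move=> x1 p0_01; have thb_01 := thetabar_bounds x1.
pose A := U @^-1` Cap gamma x.
have mA : measurable A by exact: measurable_preimage_Cap.
transitivity ('E_P[c1 p0 (thb x) \o* \1_A \+ c2 p0 (thb x) \o* \1_(~` A)])%E.
  rewrite expectation.unlock; apply: eq_integral => w _; congr _%:E.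
  by rewrite /= /pu_density !indicE in_setC mem_preimage_Cap; case: ifP => _ /=; ring.
have mAC : measurable (~` A) by exact: measurableC.
rewrite expectationD ?Lfun_scale ?Lfun_indic// !expectationZl ?Lfun_indic//.
rewrite !expectation_indic// probability_setC// thetabarE -EFinB -!EFinM -EFinD.
by congr _%:E; rewrite mulrC mulr_c1// mulrC mulr_c2//; ring.
Qed.

End PrivUnitBounds.

Lemma weighted_mean_bounds (R : realType) (dO : measure_display)
    (Omega : measurableType dO) (P : probability Omega R)
    (f g : Omega -> R) (lo hi : R) :
  measurable_fun setT f -> measurable_fun setT g ->
  (forall w, 0 <= f w) -> (forall w, 0 <= g w) ->
  (\int[P]_w (g w)%:E = 1)%E -> 0 <= lo ->
  {ae P, forall w, lo <= f w <= hi} ->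
  (lo%:E <= \int[P]_w (f w * g w)%:E <= hi%:E)%E.
Proof.
move=> mf mg f_ge0 g_ge0 g_mass lo_ge0 f_bounds.
have mscaled (k : R) : measurable_fun setT (fun w => (k * g w)%:E).
  by apply/measurable_EFinP; exact: measurable_funM.
have mfg : measurable_fun setT (fun w => (f w * g w)%:E).
  by apply/measurable_EFinP; exact: measurable_funM.
have hi_ge0 : 0 <= hi.
  have [w /andP[lo_le hi_ge]] := probability_ae_ex f_bounds.
  exact: le_trans lo_ge0 (le_trans lo_le hi_ge).
have mean_cst k : 0 <= k -> (\int[P]_w (k * g w)%:E = k%:E)%E.
  move=> k_ge0; under eq_integral do rewrite EFinM.
  rewrite ge0_integralZl//; [by rewrite g_mass mule1 | exact/measurable_EFinP |].
  by move=> w _; rewrite lee_fin.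
rewrite -(mean_cst lo)// -(mean_cst hi)//; apply/andP; split.
- apply: ae_ge0_le_integral => // [w _|w _|].
  + by rewrite lee_fin mulr_ge0.
  + by rewrite lee_fin mulr_ge0.
  + by apply: filterS f_bounds => w /andP[? _] _; rewrite lee_fin ler_wpM2r.
- apply: ae_ge0_le_integral => // [w _|w _|].
  + by rewrite lee_fin mulr_ge0.
  + by rewrite lee_fin mulr_ge0.
  + by apply: filterS f_bounds => w /andP[_ ?] _; rewrite lee_fin ler_wpM2r.
Qed.

Section Risk.
Context {R : realType} {d : nat} {dO : measure_display}
  {Omega : measurableType dO} (P : probability Omega R) (gamma p0 : R).

Definition pu_risk (U : Omega -> 'rV[R]_d) (m : R) (x : 'rV[R]_d) : R :=
  fine (\int[P]_w (sqnorm (m^-1 *: U w - x)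
    * pu_density gamma p0 (thetabar P U gamma x) x (U w))%:E).

Definition mmrc_risk {N : nat} (Z : 'I_N -> Omega -> 'rV[R]_d) (thb m : R)
    (x : 'rV[R]_d) : \bar R :=
  (\int[P]_w (\sum_(k < N) pi_mmrc gamma p0 thb x (fun j => Z j w) k
    * sqnorm (m^-1 *: Z k w - x))%:E)%E.

Hypothesis p0_01 : 0 <= p0 <= 1.

Lemma pu_risk_ge U m x : unif_sphere P U -> -1 < gamma < 1 -> sqnorm x = 1 ->
  (`|m^-1| - 1) ^+ 2 <= pu_risk U m x.
Proof.
move=> unifU gamma_bounds x1; have [mU _ _] := unifU.
have density_mass := integral_pu_density unifU gamma_bounds x1 p0_01.
have thb_01 := thetabar_bounds unifU gamma_bounds x1.
have mdensity := measurable_pu_density gamma p0 (thetabar P U gamma x) x mU.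
have density_ge0 w := pu_density_ge0 p0_01 thb_01 gamma x (U w).
have loss_bounds : {ae P, forall w,
    (`|m^-1| - 1) ^+ 2 <= sqnorm (m^-1 *: U w - x) <= (`|m^-1| + 1) ^+ 2}.
  by apply: filterS (unif_sphere_ae unifU) => w Uw1; exact: sqnormZB_bounds.
have /andP[risk_ge risk_le] := weighted_mean_bounds
  (measurable_rv_sqnormZB m^-1 x mU) mdensity (fun w => sqnorm_ge0 _) density_ge0
  density_mass (sqr_ge0 _) loss_bounds.
rewrite -lee_fin fineK// ge0_fin_numE.
  by rewrite (le_lt_trans risk_le) ?ltry.
by rewrite (le_trans _ risk_ge)// lee_fin sqr_ge0.
Qed.

Lemma mmrc_risk_le N (Z : 'I_N -> Omega -> 'rV[R]_d) thb m x :
  (0 < N)%N -> (forall k, unif_sphere P (Z k)) -> 0 < thb < 1 -> sqnorm x = 1 ->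
  (mmrc_risk Z thb m x <= ((`|m^-1| + 1) ^+ 2)%:E)%E.
Proof.
move=> N_gt0 unifZ thb_01 x1.
have mZ k : rv_measurable (Z k) by have [] := unifZ k.
pose pi w := pi_mmrc gamma p0 thb x (fun j => Z j w).
have pi_ge0 w k : 0 <= pi w k by exact: pi_mmrc_ge0.
have pi_mass w : \sum_(k < N) pi w k = 1.
  have := sum_pi_mmrc p0 thb_01 gamma x N_gt0 (fun j => Z j w) 1 1.
  rewrite !mulr1 subrKC => <-; apply: eq_bigr => k _.
  by rewrite if_same mulr1.
pose loss w := \sum_(k < N) pi w k * sqnorm (m^-1 *: Z k w - x).
have mloss : measurable_fun setT loss.
  apply: measurable_sum => k; apply: measurable_funM.
    exact: measurable_pi_mmrc.
  exact: measurable_rv_sqnormZB.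
have loss_ge0 w : 0 <= loss w.
  by apply: sumr_ge0 => k _; rewrite mulr_ge0 ?sqnorm_ge0.
have loss_le : {ae P, forall w, 0 <= loss w <= (`|m^-1| + 1) ^+ 2}.
  have Z_sphere : {ae P, forall w, forall k, sqnorm (Z k w) = 1}.
    by apply: filter_forall => k; exact: unif_sphere_ae.
  apply: filterS Z_sphere => w Zw1; rewrite loss_ge0.
  have -> : (`|m^-1| + 1) ^+ 2 = \sum_(k < N) pi w k * (`|m^-1| + 1) ^+ 2.
    by rewrite -mulr_suml pi_mass mul1r.
  apply: ler_sum => k _; rewrite ler_wpM2l//.
  by have /andP[] := sqnormZB_bounds m^-1 (Zw1 k) x1.
have P_mass : (\int[P]_w (cst 1 w)%:E = 1)%E.
  by have := expectation_cst P 1; rewrite expectation.unlock.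
have /andP[_] := weighted_mean_bounds mloss (measurable_cst (1 : R)) loss_ge0
  (fun=> ler01) P_mass (lexx 0) loss_le.
by under eq_integral do rewrite mulr1.
Qed.

End Risk.

Lemma ln_ge_onem_inv (R : realType) (y : R) : 0 < y -> 1 - y^-1 <= ln y.
Proof.
move=> y_gt0; have yV_gt0 : 0 < y^-1 by rewrite invr_gt0.
have : ln (1 + (y^-1 - 1)) <= y^-1 - 1 by apply: le_ln1Dx; lra.
by rewrite subrKC lnV ?posrE//; lra.
Qed.

Section SampleSize.
Context {R : realType} (p0 lambda : R).
Hypothesis p0_gt : 1 / 2 < p0.
Hypothesis p0_le1 : p0 <= 1.
Hypothesis lambda_gt0 : 0 < lambda.

Local Notation budget := (cap_loss_budget p0 lambda).

Lemma cap_loss_budget_gt0 : 0 < budget.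
Proof. by rewrite /cap_loss_budget divr_gt0 ?mulr_gt0 ?subr_gt0// addr_gt0. Qed.

Lemma cap_loss_budget_le : budget <= 1 / 2.
Proof.
rewrite /cap_loss_budget ler_pdivrMr ?addr_gt0//.
have : lambda * (p0 - 1 / 2) <= lambda * (1 / 2).
  by rewrite ler_pM2l//; move: p0_le1; lra.
by move: lambda_gt0; lra.
Qed.

Lemma sample_size_ge (eps n : R) :
  expR (2 * eps) / 2 * (2 * (1 + lambda) / (lambda * (p0 - 1 / 2))) ^+ 2
    * ln (4 * (1 + lambda) / (lambda * (p0 - 1 / 2))) <= n ->
  expR eps ^+ 2 <= n * budget ^+ 2.
Proof.
have budget_gt0 := cap_loss_budget_gt0; have budget_le := cap_loss_budget_le.
have budget_neq0 : budget != 0 by rewrite gt_eqF.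
have div_budgetE k : k * (1 + lambda) / (lambda * (p0 - 1 / 2)) = k / budget.
  by rewrite /cap_loss_budget invf_div mulrA.
rewrite !div_budgetE -expRM_natl => n_ge.
have ln_ge : 1 / 2 <= ln (4 / budget).
  apply: le_trans (ln_ge_onem_inv _); last exact: divr_gt0.
  by rewrite invf_div; lra.
apply: le_trans (ler_wpM2r (sqr_ge0 budget) n_ge).
have -> : expR (2 * eps) / 2 * (2 / budget) ^+ 2 * ln (4 / budget) * budget ^+ 2
  = expR (2 * eps) * (2 * ln (4 / budget)) by field.
by rewrite ler_peMr ?expR_ge0//; lra.
Qed.

Lemma sample_size_gt0 (e : R) (N : nat) :
  0 < e -> e ^+ 2 <= N%:R * budget ^+ 2 -> (0 < N)%N.
Proof.
move=> e_gt0 N_ge; rewrite lt0n; apply: contraTneq N_ge => ->.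
by rewrite mul0r -ltNge exprn_gt0.
Qed.

End SampleSize.

Lemma scaled_risk_le (R : realType) (lambda u v E : R) :
  0 <= lambda -> 0 <= v <= (1 + lambda) * u -> (`|u| - 1) ^+ 2 <= E ->
  (`|v| + 1) ^+ 2 <= (1 + lambda) ^+ 2 * E
    + 2 * (1 + lambda) * (2 + lambda) * Num.sqrt E + (2 + lambda) ^+ 2.
Proof.
move=> lambda_ge0 /andP[v_ge0 v_le] E_ge.
have E_ge0 : 0 <= E := le_trans (sqr_ge0 _) E_ge.
have u_le : `|u| <= 1 + Num.sqrt E.
  by rewrite -lerBlDl (le_trans (ler_norm _))// -sqrtr_sqr ler_wsqrtr.
have v_bound : v + 1 <= (1 + lambda) * Num.sqrt E + (2 + lambda).
  have : (1 + lambda) * u <= (1 + lambda) * (1 + Num.sqrt E).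
    by rewrite ler_wpM2l ?(le_trans (ler_norm u))//; lra.
  by lra.
have -> : (1 + lambda) ^+ 2 * E + 2 * (1 + lambda) * (2 + lambda) * Num.sqrt E
    + (2 + lambda) ^+ 2 = ((1 + lambda) * Num.sqrt E + (2 + lambda)) ^+ 2.
  by rewrite -{1}(sqr_sqrtr E_ge0); ring.
by rewrite ger0_norm// lerXn2r// nnegrE; lra.
Qed.

Theorem theorem6 (R : realType) (d N : nat) (eps p0 gamma lambda : R)
  (dO : measure_display) (Omega : measurableType dO) (P : probability Omega R)
  (U : Omega -> 'rV[R]_d) (Z : 'I_N -> Omega -> 'rV[R]_d) :
  (2 <= d)%N ->
  0 <= gamma -> gamma < 1 ->
  1 / 2 < p0 -> p0 <= 1 ->
  (* U ~ Unif(S^{d-1}) (reference measure); Z_1..Z_N i.i.d. Unif(S^{d-1}) *)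
  unif_sphere P U ->
  (forall k, unif_sphere P (Z k)) ->
  mutually_indep P Z ->
  (* PrivUnit2 with parameters p0, gamma is eps-LDP *)
  (forall x x' z : 'rV[R]_d, sqnorm x = 1 -> sqnorm x' = 1 -> sqnorm z = 1 ->
     pu_density gamma p0 (thetabar P U gamma x) x z <=
     expR eps * pu_density gamma p0 (thetabar P U gamma x') x' z) ->
  0 < lambda ->
  expR (2 * eps) / 2 * (2 * (1 + lambda) / (lambda * (p0 - 1 / 2))) ^+ 2
    * ln (4 * (1 + lambda) / (lambda * (p0 - 1 / 2))) <= N%:R ->
  forall x : 'rV[R]_d, sqnorm x = 1 ->
  let thb := thetabar P U gamma x in
  let m_pu := mPU d gamma p0 in
  let E := fine (\int[P]_w
             (sqnorm (m_pu^-1 *: U w - x) * pu_density gamma p0 thb x (U w))%:E) in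
  let pi := fun w => pi_mmrc gamma p0 thb x (fun k => Z k w) in
  let p_mmrc := fine (\int[P]_w
             (\sum_(k < N) pi w k * (if gamma <= dotv (Z k w) x then 1 else 0))%:E) in
  let m_mmrc := mPU d gamma p_mmrc in
  (\int[P]_w (\sum_(k < N) pi w k * sqnorm (m_mmrc^-1 *: Z k w - x))%:E
    <= ((1 + lambda) ^+ 2 * E + 2 * (1 + lambda) * (2 + lambda) * Num.sqrt E
        + (2 + lambda) ^+ 2)%:E)%E.
Proof.
move=> d_ge2 gamma_ge0 gamma_lt1 p0_gt p0_le1 unifU unifZ indepZ ldp.
move=> lambda_gt0 N_ge x x1 /=.
set thb := thetabar P U gamma x; set m_pu := mPU d gamma p0.
set p_mmrc := fine _; set m_mmrc := mPU d gamma p_mmrc; set E := fine _.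
have p0_01 : 0 <= p0 <= 1 by apply/andP; lra.
have gamma_01 : 0 <= gamma < 1 by apply/andP.
have gamma_bounds : -1 < gamma < 1 by apply/andP; lra.
have thb_01 : 0 < thb < 1 := thetabar_bounds unifU gamma_bounds x1.
have Z_cap k : P (Z k @^-1` Cap gamma x) = thb%:E.
  by rewrite -(Cap_probability_unique gamma unifU (unifZ k) x1) thetabarE.
have mZ k : rv_measurable (Z k) by have [] := unifZ k.
have c1_le : c1 p0 thb <= expR eps := c1_le_expR unifU gamma_bounds ldp x1.
have budget_ge0 := ltW (cap_loss_budget_gt0 p0_gt lambda_gt0).
have N_budget := sample_size_ge p0_gt p0_le1 lambda_gt0 N_ge.
have N_gt0 := sample_size_gt0 (expR_gt0 eps) N_budget.
have p_mmrc_ge : p0 - cap_loss_budget p0 lambda <= p_mmrc.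
  exact: mmrc_cap_probability_loss c1_le budget_ge0 N_budget.
have m_mmrc_bounds := mPU_inv_le d_ge2 gamma_01 p0_gt lambda_gt0 p_mmrc_ge.
have E_ge : (`|m_pu^-1| - 1) ^+ 2 <= E :=
  pu_risk_ge p0_01 m_pu unifU gamma_bounds x1.
apply: le_trans (mmrc_risk_le gamma p0_01 m_mmrc N_gt0 unifZ thb_01 x1) _.
by rewrite lee_fin; exact: scaled_risk_le (ltW lambda_gt0) m_mmrc_bounds E_ge.
Qed.
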